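(* Let $G$ be a graph on $V=\{v_1,\dots,v_n\}$ with adjacency matrix $A$ whose characteristic polynomial $\det(x{\rm I}-A)$ is irreducible over $\mathbb{Q}$. Let $S\subseteq V$ be any non-empty set. If $G^*$ is any graph on $V$ with adjacency matrix $A^*$ and $S^*\subseteq V$ is non-empty with $W^{S^*}_{G^*}=W^S_G$, then $A^*=A$. (That is, $W^S_G$ determines the adjacency matrix of $G$ for every non-empty $S$.)
   Context: Graphs are finite, simple, undirected. For a graph $G$ with vertex set $V=\{v_1,\dots,v_n\}$, adjacency matrix $A$, and non-empty $S\subseteq V$ with characteristic vector ${\rm e}\in\{0,1\}^n$, the walk matrix is $W^S_G=[{\rm e},A{\rm e},\dots,A^{n-1}{\rm e}]$. *)

(* Defs.v *)
From HB Require Import structures.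
From mathcomp Require Import all_boot all_order all_algebra.
Set Implicit Arguments.
Unset Strict Implicit.
Unset Printing Implicit Defensive.
Import GRing.Theory.
Local Open Scope ring_scope.

Record sgraph (n : nat) := SGraph {
  edge :> rel 'I_n;
  edge_sym : symmetric edge;
  edge_irr : irreflexive edge
}.

(* All matrices are taken over rat, so that irreducibility of [char_poly]
   in {poly rat} is irreducibility over the rationals. *)
Definition adjacency (n : nat) (G : sgraph n) : 'M[rat]_n :=
  \matrix_(i, j) (G i j)%:R.

Definition char_vec (n : nat) (S : {set 'I_n}) : 'cV[rat]_n :=
  \col_i (i \in S)%:R.

(* Column j, counted from 0, is A^j e. *)
Definition walk_matrix (n : nat) (G : sgraph n) (S : {set 'I_n}) : 'M[rat]_n :=
  \matrix_(i, j) ((adjacency G ^+ j) *m char_vec S) i 0.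

(* Main.v *)
Require Import Defs.
From HB Require Import structures.
From mathcomp Require Import all_boot all_order all_algebra.
Set Implicit Arguments.
Unset Strict Implicit.
Unset Printing Implicit Defensive.
Import GRing.Theory.
Local Open Scope ring_scope.

(** If the characteristic polynomial of A is irreducible, every nonzero vector
    is cyclic for A, so the walk matrix W is invertible. Two graphs with the
    same W have the same e, and D = A' - A kills e, A e, ..., A^(n-2) e; that is,
    only the last column of D W can be nonzero, so D has rank at most one.
    A symmetric matrix of rank at most one with zero diagonal vanishes. *)

(** [walk_matrix G S] is convertible to the instance at [adjacency G] and [char_vec S], so [eqW]
    applies to it directly. *)
Definition krylov_mx (F : fieldType) (n : nat) (A : 'M[F]_n) (x : 'cV[F]_n) :
    'M[F]_n :=
  \matrix_(i, j) (A ^+ j *m x) i 0.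

Lemma col_krylov_mx (F : fieldType) (n : nat) (A : 'M[F]_n) (x : 'cV[F]_n)
    (j : 'I_n) :
  col j (krylov_mx A x) = A ^+ j *m x.
Proof. by apply/colP => i; rewrite !mxE. Qed.

Lemma krylov_mx_mul_rVpoly (F : fieldType) (n : nat) (A : 'M[F]_n.+1)
    (x : 'cV[F]_n.+1) (v : 'rV[F]_n.+1) :
  krylov_mx A x *m v^T = horner_mx A (rVpoly v) *m x.
Proof.
rewrite horner_rVpoly mulmx_sum_row linear_sum mulmx_suml.
apply/colP => i; rewrite mxE summxE; apply: eq_bigr => j _.
by rewrite rowK linearZ /= mxvecK -scalemxAl !mxE mulrC.
Qed.

(** A nonzero kernel vector gives a nonzero polynomial [p] with p(A) x = 0, of degree too small to
    be divisible by [char_poly A], hence coprime to it. *)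
Lemma irreducible_krylov_mx_unit (F : fieldType) (n : nat) (A : 'M[F]_n.+1)
    (x : 'cV[F]_n.+1) :
  irreducible_poly (char_poly A) -> x != 0 -> krylov_mx A x \in unitmx.
Proof.
move=> irrA x_neq0; rewrite -unitmx_tr -row_free_unit -kermx_eq0.
apply: contraNT x_neq0 => /rowV0Pn [v /sub_kermxP vW0 v_neq0].
set p := rVpoly v.
have px0 : horner_mx A p *m x = 0.
  by rewrite -krylov_mx_mul_rVpoly -[LHS]trmxK trmx_mul trmxK vW0 trmx0.
have p_neq0 : p != 0.
  by apply: contraNneq v_neq0 => p0; rewrite -[v]rVpolyK -/p p0 linear0.
have : coprimep (char_poly A) p.
  rewrite (irreducible_poly_coprime _ irrA); apply/negP => /(dvdp_leq p_neq0).
  by rewrite size_char_poly leqNgt ltnS size_poly.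
(* Evaluate the Bezout identity at [A] and apply it to [x]: Cayley-Hamilton kills one term, [px0]
   the other, leaving x = 0. *)
case/Bezout_eq1_coprimepP => -[u w] /= /(congr1 (horner_mx A)).
move/(congr1 (mulmx^~ x)) => /=.
rewrite rmorphD !rmorphM /= Cayley_Hamilton mulr0 add0r rmorph1 mul1mx.
by rewrite -mulmxA px0 mulmx0 => <-.
Qed.

(** By symmetry D_ij^2 = D_ij D_ji = (c_i u_j)(c_j u_i) = D_ii D_jj = 0. *)
Lemma sym_rank1_diag0 (R : idomainType) (n : nat) (D : 'M[R]_n)
    (c : 'cV[R]_n) (u : 'rV[R]_n) :
  D = c *m u -> D^T = D -> (forall i, D i i = 0) -> D = 0.
Proof.
move=> Dcu symD diagD.
have DE i j : D i j = c i 0 * u 0 j by rewrite Dcu !mxE big_ord1.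
apply/matrixP => i j; rewrite [RHS]mxE; apply/eqP; rewrite -sqrf_eq0 expr2.
by rewrite -{2}symD mxE !DE mulrACA (mulrC (u 0 j)) mulrACA -!DE diagD mul0r.
Qed.

Lemma krylov_mx_eq_rank1 (F : fieldType) (n : nat) (A B : 'M[F]_n.+1)
    (x y : 'cV[F]_n.+1) :
  krylov_mx A x \in unitmx -> krylov_mx B y = krylov_mx A x ->
  exists (c : 'cV[F]_n.+1) (u : 'rV[F]_n.+1), B - A = c *m u.
Proof.
set W := krylov_mx A x => W_unit eqW.
have eq_pow (j : nat) : (j < n.+1)%N -> B ^+ j *m y = A ^+ j *m x.
  by move=> lt_jn; rewrite -!(col_krylov_mx _ _ (Ordinal lt_jn)) eqW.
have DW0 j : j != ord_max -> col j ((B - A) *m W) = 0.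
  move=> j_max; have lt_jn : (j.+1 < n.+1)%N.
    by rewrite ltn_neqAle ltn_ord andbT eqSS; exact: j_max.
  (* With [W] read as [krylov_mx B y] in the product with [B], column j becomes B^(j+1) y - A^(j+1)
     x, and column j+1 exists because j is not last. *)
  rewrite colE -mulmxA -colE mulmxBl -{1}eqW !col_krylov_mx !mulmxA.
  by rewrite !mulmxE -!exprS eq_pow ?subrr.
(* Expand B - A = ((B - A) W) W^-1 as a sum of columns times rows: only the last term survives. *)
exists (col ord_max ((B - A) *m W)), (row ord_max (invmx W)).
rewrite -{1}[B - A](mulmxK W_unit); apply/matrixP => i j.
rewrite !mxE big_ord1 (bigD1 ord_max) //= big1 ?addr0.
  by rewrite [in RHS]mxE [in X in _ = _ * X]mxE.
by move=> k /DW0 /colP /(_ i); rewrite [in X in X -> _]mxE => ->; rewrite mxE mul0r.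
Qed.

Lemma trmx_adjacency (n : nat) (G : sgraph n) : (adjacency G)^T = adjacency G.
Proof. by apply/matrixP => i j; rewrite !mxE edge_sym. Qed.

Lemma adjacency_diag (n : nat) (G : sgraph n) (i : 'I_n) : adjacency G i i = 0.
Proof. by rewrite mxE edge_irr. Qed.

Lemma char_vec_eq0 (n : nat) (S : {set 'I_n}) : (char_vec S == 0) = (S == set0).
Proof.
apply/eqP/eqP => [/colP S0 | ->]; last by apply/colP => i; rewrite !mxE inE.
apply/setP => i; move: (S0 i); rewrite !mxE inE.
by case: (i \in S) => // /eqP; rewrite oner_eq0.
Qed.

Theorem theorem5p2 (n : nat) (G : sgraph n) (S : {set 'I_n})
    (irrG : irreducible_poly (char_poly (adjacency G)))
    (S_neq0 : S != set0)
    (G' : sgraph n) (S' : {set 'I_n}) (S'_neq0 : S' != set0)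
    (eqW : walk_matrix G' S' = walk_matrix G S) :
  adjacency G' = adjacency G.
Proof.
case: n G S irrG S_neq0 G' S' S'_neq0 eqW => [|n] G S irrG S_neq0 G' S' _ eqW.
  by apply/matrixP => -[].
have W_unit : krylov_mx (adjacency G) (char_vec S) \in unitmx.
  by apply: irreducible_krylov_mx_unit; rewrite ?char_vec_eq0.
have [c [u Dcu]] := krylov_mx_eq_rank1 W_unit eqW.
apply/eqP; rewrite -subr_eq0; apply/eqP; apply: (sym_rank1_diag0 Dcu).
  by rewrite linearB /= !trmx_adjacency.
by move=> i; rewrite mxE adjacency_diag add0r mxE adjacency_diag oppr0.
Qed.
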